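(* Let $A\in\mathbb{C}^{n\times n}$ and let $\lambda$ be an eigenvalue of $A$ of algebraic multiplicity $m$ whose nonzero Weyr characteristic is $m_1\ge m_2\ge\cdots\ge m_k>0$. Set $\mu_0=0$, $\mu_j=m_1+\cdots+m_j$ for $j=1,\dots,k$, and $$\Phi_\lambda=\{(i,j)\;:\;\mu_{l-1}<i\le\mu_l,\ i<j\le\mu_l,\ l=1,\dots,k\}.$$ Then for almost all $\mathbf{b}_1,\dots,\mathbf{b}_m\in\mathbb{C}^n$ there exist a matrix $U=[\mathbf{u}_1,\dots,\mathbf{u}_m]\in\mathbb{C}^{n\times m}$ with $U^{\mathsf H}U=I_m$ and a staircase nilpotent matrix $S\in\mathbb{C}^{m\times m}$ (with respect to $m_1,\dots,m_k$) such that $$AU-U(\lambda I_m+S)=O\quad\text{and}\quad \mathbf{u}_i^{\mathsf H}\mathbf{b}_j=0\ \text{ for every }(i,j)\in\Phi_\lambda.$$ Moreover, if $\hat U=[\hat{\mathbf u}_1,\dots,\hat{\mathbf u}_m]\in\mathbb{C}^{n\times m}$ with $\hat U^{\mathsf H}\hat U=I_m$ and a staircase nilpotent matrix $\hat S$ also satisfy these two conditions in place of $U$ and $S$, then $\hat S=\hat U^{\mathsf H}(A-\lambda I)\hat U$, where $\hat U=UD$ for a diagonal matrix $D=\mathrm{diag}(\alpha_1,\dots,\alpha_m)$ with $|\alpha_1|=\cdots=|\alpha_m|=1$.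
   Context: The Weyr characteristic of $A$ at $\lambda$ is the sequence $m_j=\dim\ker(A-\lambda I)^j-\dim\ker(A-\lambda I)^{j-1}$, $j=1,2,\dots$; it is nonincreasing, its nonzero part is $m_1\ge\cdots\ge m_k$, and $m_1+\cdots+m_k=m$. A staircase nilpotent matrix with respect to $m_1,\dots,m_k$ is a matrix $S\in\mathbb{C}^{m\times m}$ which, partitioned into blocks $S_{ij}\in\mathbb{C}^{m_i\times m_j}$ ($1\le i,j\le k$), has $S_{ij}=O$ whenever $i\ge j$ (zero diagonal blocks and zero blocks below the block diagonal). $X^{\mathsf H}$ denotes the conjugate transpose. ''For almost all'' means for all vectors outside a subset of Lebesgue measure zero. *)

(* Defs.v *)
From HB Require Import structures.
From mathcomp Require Import all_boot all_order all_algebra.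
From mathcomp Require Import complex.
From mathcomp Require Import reals.
Set Implicit Arguments. Unset Strict Implicit. Unset Printing Implicit Defensive.
Import Order.TTheory GRing.Theory Num.Theory.
Local Open Scope ring_scope.

Definition mxH (C : numClosedFieldType) (p q : nat) (X : 'M[C]_(p, q)) : 'M[C]_(q, p) :=
  (map_mx Num.conj X)^T.

(* dim ker M  for a square matrix M acting on column vectors:
   {v | M v = 0} = {v | v^T M^T = 0}, the row kernel of M^T *)
Definition dimker (F : fieldType) (n : nat) (M : 'M[F]_n) : nat :=
  \rank (kermx M^T).

Definition weyr (F : fieldType) (n : nat) (A : 'M[F]_n) (lambda : F) (j : nat) : nat :=
  (dimker ((A - lambda%:M) ^+ j) - dimker ((A - lambda%:M) ^+ j.-1))%N.

Definition mu (ms : seq nat) (l : nat) : nat := (\sum_(i < l) nth 0 ms i)%N.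

(* 0-based block index of the 0-based index p: the number of l in 1..k with mu_l <= p
   (so block l (1-based) = block index l-1 consists of mu_{l-1} <= p < mu_l) *)
Definition blk (ms : seq nat) (p : nat) : nat :=
  count (fun l => mu ms l.+1 <= p)%N (iota 0 (size ms)).

Definition staircase (C : pzRingType) (m : nat) (ms : seq nat) (S : 'M[C]_m) : Prop :=
  forall p q : 'I_m, (blk ms q <= blk ms p)%N -> S p q = 0.

Definition inPhi (ms : seq nat) (i j : nat) : bool :=
  (i < j)%N && (blk ms i == blk ms j).

(* Lebesgue-null subsets of C^{n x m} = R^{2nm} (real and imaginary parts of entries):
   for every eps > 0, covered by countably many closed boxes of total volume <= eps. *)
Definition realcoord (R : realType) (n m : nat) (B : 'M[R[i]]_(n, m))
  (x : 'I_n * 'I_m * bool) : R :=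
  if x.2 then complex.Re (B x.1.1 x.1.2) else complex.Im (B x.1.1 x.1.2).

Definition mx_null (R : realType) (n m : nat) (E : 'M[R[i]]_(n, m) -> Prop) : Prop :=
  forall eps : R, 0 < eps ->
  exists lo hi : nat -> 'I_n * 'I_m * bool -> R,
    (forall k x, lo k x <= hi k x) /\
    (forall N, \sum_(k < N) \prod_(x : 'I_n * 'I_m * bool) (hi k x - lo k x) <= eps) /\
    (forall B, E B -> exists k, forall x,
        lo k x <= realcoord B x <= hi k x).

(* Main.v *)
(** Put K_l = ker (A - lambda)^l.  Since dim K_l = mu_l, the pairs (U, S) with
    U orthonormal, S staircase and A U = U (lambda + S) are exactly the
    orthonormal families whose l-th block lies in, hence spans, the orthogonal
    complement of K_(l-1) in K_l.  After fixing one such family Q, every other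
    one is Q times a block-diagonal unitary matrix, and the orthogonality
    conditions say that this unitary factor (conjugated) times M is lower
    triangular, where M is the block-diagonal part of Q^H B.  When M is
    invertible this is a QL factorization: it exists, and its unitary factor is
    unique up to phases.

    It remains to see that {B | det M = 0} is null.  If M v = 0 with v_j <> 0,
    then column j of B is determined by the other columns of B, by v / v_j
    restricted to the block of j and by a vector orthogonal to the block of Q;
    counting parameters, B lies in the image of a polynomial map from a space
    of complex dimension n m - 1.  Such an image is null because a locally
    Lipschitz map covers the image of a grid of N^d cubes by N^d cubes of side
    O(1/N) in dimension D > d. *)

Require Import Defs.
From HB Require Import structures.
From mathcomp Require Import all_boot all_order all_algebra.
From mathcomp Require Import complex.
From mathcomp Require Import boolp reals.
From mathcomp Require Import ring lra.
Set Implicit Arguments. Unset Strict Implicit. Unset Printing Implicit Defensive.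
Import Order.TTheory GRing.Theory Num.Theory.
Local Open Scope ring_scope.

(** * Orthonormal families adapted to a flag of subspaces *)

Section Orthonormal.
Variable C : numClosedFieldType.

Lemma mxHM p q r (X : 'M[C]_(p, q)) (Y : 'M_(q, r)) :
  mxH (X *m Y) = mxH Y *m mxH X.
Proof. by rewrite /mxH map_mxM trmx_mul. Qed.

Lemma mxHK p q (X : 'M[C]_(p, q)) : mxH (mxH X) = X.
Proof. by apply/matrixP=> i j; rewrite !mxE conjCK. Qed.

Lemma mxHE p q (X : 'M[C]_(p, q)) i j : mxH X i j = (X j i)^*.
Proof. by rewrite !mxE. Qed.

Lemma mxH_mulmxE p q r (X : 'M[C]_(p, q)) (Y : 'M_(r, q)) i j :
  (X *m mxH Y) i j = (row i X *m mxH (row j Y)) 0 0.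
Proof. by rewrite !mxE; apply: eq_bigr => k _; rewrite !mxE. Qed.

Lemma dnorm_ge0 n (v : 'rV[C]_n) : 0 <= (v *m mxH v) 0 0.
Proof.
by rewrite mxE sumr_ge0 // => k _; rewrite !mxE mul_conjC_ge0.
Qed.

Lemma dnorm_eq0 n (v : 'rV[C]_n) : ((v *m mxH v) 0 0 == 0) = (v == 0).
Proof.
apply/eqP/eqP => [|->]; last by rewrite mul0mx mxE.
rewrite mxE => /psumr_eq0P v0; apply/rowP => k; rewrite mxE.
have := v0 _ k isT; rewrite !mxE => v0k.
by apply/eqP; rewrite -mul_conjC_eq0 v0k // => i _; rewrite !mxE mul_conjC_ge0.
Qed.

Lemma orthonormal_rank p n (X : 'M[C]_(p, n)) :
  X *m mxH X = 1%:M -> \rank X = p.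
Proof.
move=> XX; apply/eqP; rewrite eqn_leq rank_leq_row /=.
by have := mxrankM_maxl X (mxH X); rewrite XX mxrank1.
Qed.

Lemma orthonormal_rowsub p r n (X : 'M[C]_(p, n)) (f : 'I_r -> 'I_p) :
  injective f -> X *m mxH X = 1%:M ->
  rowsub f X *m mxH (rowsub f X) = 1%:M.
Proof.
move=> f_inj XX; apply/matrixP => i j.
transitivity ((X *m mxH X) (f i) (f j)).
  by rewrite !mxE; apply: eq_bigr => k _; rewrite !mxE.
by rewrite XX !mxE (inj_eq f_inj).
Qed.

(* Greedy choice: rank (F i) > i leaves room in F i for a unit vector orthogonal
   to the i earlier rows. *)
Lemma flag_orthonormal n (F : nat -> 'M[C]_n) (m : nat) :
  (forall i, (i < m)%N -> (i < \rank (F i))%N) ->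
  exists2 X : 'M[C]_(m, n), X *m mxH X = 1%:M &
    forall i : 'I_m, (row i X <= F i)%MS.
Proof.
move=> rF.
(* The rows are first built as a function on [nat], so that the induction on [m] adds one value
   instead of resizing a matrix. *)
have [g [gg gF]] : exists g : nat -> 'rV[C]_n,
    (forall i j, (i < m)%N -> (j < m)%N ->
       (g i *m mxH (g j)) 0 0 = (i == j)%:R) /\
    (forall i, (i < m)%N -> (g i <= F i)%MS).
  elim: m rF => [|m IH] rF; first by exists (fun=> 0); split.
  case: IH => [i /ltnW/rF//|g [gg gF]].
  pose X : 'M[C]_(m, n) := \matrix_(i < m) g i.
  pose K := kermx (row_base (F m) *m mxH X).
  have /rowV0Pn[x xK x0] : K != 0.
    rewrite -mxrank_eq0 -lt0n mxrank_ker subn_gt0.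
    by rewrite (leq_ltn_trans (rank_leq_col _)) // rF.
  pose v := x *m row_base (F m).
  have v0 : v != 0.
    apply: contraNneq x0 => v0; apply/eqP.
    by apply: (row_free_inj (row_base_free (F m))); rewrite mul0mx.
  have vX : v *m mxH X = 0 by rewrite -mulmxA; exact/sub_kermxP.
  pose c := sqrtC ((v *m mxH v) 0 0).
  have c_gt0 : 0 < c by rewrite sqrtC_gt0 lt_neqAle dnorm_ge0 eq_sym dnorm_eq0 v0.
  pose u := c^-1 *: v.
  have uu : (u *m mxH u) 0 0 = 1.
    rewrite -scalemxAl mxE.
    have -> : mxH u = c^-1 *: mxH v.
      apply/matrixP => i j; rewrite !mxE rmorphM /=; congr (_ * _).
      by rewrite geC0_conj // invr_ge0 ltW.
    rewrite -scalemxAr mxE -[(v *m _) 0 0]sqrtCK -/c expr2.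
    by rewrite mulKf ?mulVf // gt_eqF.
  have uX i : (i < m)%N -> (u *m mxH (g i)) 0 0 = 0.
    move=> im; have := congr1 (fun M : 'rV_m => M 0 (Ordinal im)) vX.
    rewrite mxH_mulmxE rowK row_id [RHS]mxE => vg.
    by rewrite -scalemxAl mxE vg mulr0.
  have Xu i : (i < m)%N -> (g i *m mxH u) 0 0 = 0.
    move=> /uX/(congr1 (fun z => Num.conj z)); rewrite rmorph0 => <-.
    have -> : g i *m mxH u = mxH (u *m mxH (g i)) by rewrite mxHM mxHK.
    by rewrite !mxE.
  exists (fun i => if i == m then u else g i); split.
    move=> i j; rewrite !ltnS [(i <= m)%N]leq_eqVlt [(j <= m)%N]leq_eqVlt.
    case: (eqVneq i m) => [->|im] /=; case: (eqVneq j m) => [->|jm] //=.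
    - by move=> _ /uX.
    - by move=> im' _; rewrite Xu // (negPf im).
    - exact: gg.
  move=> i; rewrite ltnS leq_eqVlt; case: eqP => [->|_] /= im; last exact: gF.
  by rewrite scalemx_sub // -(eq_row_base (F m)) submxMl.
exists (\matrix_(i < m) g i); last by move=> i; rewrite rowK gF.
by apply/matrixP => i j; rewrite mxH_mulmxE !rowK gg // mxE.
Qed.

(** The first [r] rows of [X] are [r] independent vectors in a space of rank at most [r], so they
    span [F]; the later rows are orthogonal to them. *)
Lemma flag_coord m n (X : 'M[C]_(m, n)) (F : 'M[C]_n) (r : nat) (v : 'rV_n) :
  X *m mxH X = 1%:M -> (r <= m)%N -> (\rank F <= r)%N ->
  (forall i : 'I_m, (i < r)%N -> (row i X <= F)%MS) -> (v <= F)%MS ->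
  v = v *m mxH X *m X /\
  forall j : 'I_m, (r <= j)%N -> (v *m mxH X) 0 j = 0.
Proof.
move=> XX rm rF XF vF.
pose Y := rowsub (widen_ord rm) X.
have YX : Y *m mxH X = \matrix_(i, j) (widen_ord rm i == j)%:R.
  apply/matrixP => i j; transitivity ((X *m mxH X) (widen_ord rm i) j).
    by rewrite !mxE; apply: eq_bigr => k _; rewrite !mxE.
  by rewrite XX !mxE.
have YF : (Y <= F)%MS.
  by apply/row_subP => i; rewrite row_rowsub XF //=.
have rY : \rank Y = r.
  apply: orthonormal_rank; apply: orthonormal_rowsub => //.
  by move=> i j /(congr1 val) /= /val_inj.
have /submxP[w vw] : (v <= Y)%MS.
  apply: submx_trans vF _; rewrite -(mxrank_leqif_sup YF).
  by rewrite eqn_leq mxrankS // rY.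
have YXX : Y *m mxH X *m X = Y.
  by rewrite /Y !mul_rowsub_mx XX mul1mx.
split; first by rewrite vw -!mulmxA [Y *m _]mulmxA YXX.
move=> j rj; rewrite vw -mulmxA YX mxE big1 // => k _.
rewrite !mxE [_ == _]negbTE ?mulr0 // -val_eqE neq_ltn /=.
by rewrite (leq_trans (ltn_ord k) rj).
Qed.

End Orthonormal.

(** * Characteristic polynomials and algebraic multiplicity *)

Lemma char_poly_tr (R : comNzRingType) n (A : 'M[R]_n) :
  char_poly A^T = char_poly A.
Proof.
rewrite /char_poly -det_tr; congr (\det _).
by apply/matrixP => i j; rewrite !mxE eq_sym.
Qed.

Lemma char_poly_similar (F : fieldType) n (P A : 'M[F]_n) :
  P \in unitmx -> char_poly (P *m A *m invmx P) = char_poly A.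
Proof.
move=> Pu; rewrite /char_poly /char_poly_mx.
have PP : map_mx polyC P *m map_mx polyC (invmx P) = 1%:M.
  by rewrite -map_mxM mulmxV // map_mx1.
have -> : 'X%:M - map_mx polyC (P *m A *m invmx P) =
    map_mx polyC P *m ('X%:M - map_mx polyC A) *m map_mx polyC (invmx P).
  rewrite mulmxBr mulmxBl !map_mxM; congr (_ - _).
  by rewrite scalar_mxC -mulmxA PP mulmx1.
by rewrite !det_mulmx mulrAC -det_mulmx PP det1 mul1r.
Qed.

Lemma char_poly_lblock (R : comNzRingType) r s (A : 'M[R]_r) (B : 'M_(s, r))
    (D : 'M_s) :
  char_poly (block_mx A 0 B D) = char_poly A * char_poly D.
Proof.
rewrite /char_poly /char_poly_mx map_block_mx /= map_mx0 scalar_mx_block.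
by rewrite opp_block_mx add_block_mx oppr0 !add0r det_lblock.
Qed.

(* In a basis extending one of K = ker (M - lambda)^k, M is block lower triangular:
   the diagonal block on K is lambda plus a nilpotent, and the other one does
   not have the eigenvalue lambda because the kernels have stabilized. *)
Lemma mup_char_poly_kermx (F : closedFieldType) n (M : 'M[F]_n) lambda k :
  (kermx ((M - lambda%:M) ^+ k.+1) <= kermx ((M - lambda%:M) ^+ k))%MS ->
  mup lambda (char_poly M) = \rank (kermx ((M - lambda%:M) ^+ k)).
Proof.
move=> Kstab.
have [r rE] : exists r, r = \rank (kermx ((M - lambda%:M) ^+ k)) by eexists.
have [s sE] : exists s, n = (r + s)%N.
  by exists (n - r)%N; rewrite subnKC // rE rank_leq_row.
subst n; move: Kstab rE; set N := M - lambda%:M; set K := kermx (N ^+ k).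
move=> Kstab rE; have ME : M = N + lambda%:M by rewrite subrK.
have KN : (K *m N <= K)%MS.
  apply: submx_trans (_ : K *m N <= kermx (N ^+ k))%MS _ => //.
  apply/sub_kermxP; rewrite -mulmxA mulmxE -exprS exprSr -mulmxE.
  by rewrite mulmxA mulmx_ker mul0mx.
(* The first [r] rows of the invertible [P], extracted as [E *m P], form a basis of [K]; [W] below
   is the matrix of [N] on [K] in this basis. *)
rewrite -rE; pose P := row_ebase K.
have Pu : P \in unitmx := row_ebase_unit K.
pose E : 'M[F]_(r, r + s) := row_mx 1%:M 0.
have KE : K = col_ebase K *m col_mx E 0 *m P.
  rewrite -[LHS]mulmx_ebase -rE pid_mx_block /block_mx.
  by rewrite [row_mx 0 0](row_mx0).
have EP : (E *m P :=: K)%MS.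
  apply/eqmxP/andP; split.
    rewrite KE -mulmxA (eqmxMfull _ (_ : row_full (col_ebase K))).
      by rewrite mul_col_mx -addsmxE addsmxSl.
    by rewrite row_full_unit col_ebase_unit.
  rewrite {1}KE -mulmxA; apply: submx_trans (submxMl _ _) _.
  by rewrite mul_col_mx mul0mx -addsmxE addsmx_sub submx_refl sub0mx.
have /submxP[W WE] : (E *m P *m N <= E *m P)%MS.
  by rewrite (eqmxMr N EP) EP.
have EPfree : row_free (E *m P).
  by rewrite /row_free EP eq_sym; apply/eqP.
have Wk j : W ^+ j *m (E *m P) = E *m P *m N ^+ j.
  elim: j => [|j IH]; first by rewrite !expr0 mul1mx mulmx1.
  rewrite exprSr -mulmxE -mulmxA -WE mulmxA IH.
  by rewrite -!mulmxA !mulmxE -exprSr.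
have W0 : W ^+ k = 0.
  apply: (row_free_inj EPfree); rewrite mul0mx Wk.
  by apply/sub_kermxP; rewrite EP.
pose L := P *m N *m invmx P.
have LE : L = block_mx W 0 (dlsubmx L) (drsubmx L).
  have UL : usubmx L = row_mx W 0.
    have -> : usubmx L = E *m L.
      by rewrite -[L in RHS]vsubmxK mul_row_col mul1mx mul0mx addr0.
    rewrite /L !mulmxA WE -!mulmxA mulmxV // mulmx1.
    by rewrite mul_mx_row mulmx1 mulmx0.
  rewrite -[LHS]vsubmxK UL /block_mx; congr col_mx.
  by rewrite [RHS]hsubmxK.
have -> : char_poly M =
    char_poly (W + lambda%:M) * char_poly (drsubmx L + lambda%:M).
  rewrite -(char_poly_similar M Pu) ME mulmxDr mulmxDl -/L.
  rewrite scalar_mxC -mulmxA mulmxV // mulmx1 LE scalar_mx_block.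
  by rewrite add_block_mx !addr0 char_poly_lblock -LE.
have lead_neq0 p (B : 'M[F]_p) : char_poly B != 0.
  by rewrite monic_neq0 // char_poly_monic.
rewrite mupMl.
  have [rs] := closed_field_poly_normal (char_poly (W + lambda%:M)).
  rewrite (monicP (char_poly_monic _)) scale1r => Wrs.
  have rs_size : size rs = r.
    have := size_char_poly (W + lambda%:M).
    by rewrite Wrs size_prod_XsubC => -[].
  have /all_pred1P rs_lambda : all (pred1 lambda) rs.
    apply/allP => z zrs; have : root (char_poly (W + lambda%:M)) z.
      by rewrite Wrs root_prod_XsubC.
    rewrite -eigenvalue_root_char => /eigenvalueP[x].
    rewrite mulmxDr mul_mx_scalar => /esym/eqP; rewrite -subr_eq -scalerBl.
    move=> /eqP xW x0.
    have xWj j : x *m W ^+ j = (z - lambda) ^+ j *: x.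
      elim: j => [|j IH]; first by rewrite !expr0 mulmx1 scale1r.
      by rewrite exprS -mulmxE mulmxA -xW -scalemxAl IH scalerA -exprS.
    have /esym/eqP := xWj k.
    rewrite W0 mulmx0 scaler_eq0 (negPf x0) orbF expf_eq0 subr_eq0.
    by case/andP.
  rewrite Wrs rs_lambda rs_size big_nseq iter_mulr_1.
  by rewrite mup_XsubCX eqxx.
apply/negP; rewrite -eigenvalue_root_char => /eigenvalueP[x].
rewrite mulmxDr mul_mx_scalar -[RHS]add0r => /addIr xD x0.
(* [N] sends [y *m P] into [K], so [N ^+ k.+1] kills it. By stability it already lies in [K], whose
   members have last [s] coordinates zero in the basis [P]; this forces [x = 0]. *)
pose y : 'rV_(r + s) := row_mx 0 x.
have yL : y *m L = x *m dlsubmx L *m E.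
  rewrite LE mul_row_block !mul0mx !add0r xD mul_mx_row mulmx1 mulmx0.
  by rewrite block_mxKdl.
have yPker : (y *m P <= kermx (N ^+ k.+1))%MS.
  apply/sub_kermxP; rewrite exprS -mulmxE mulmxA.
  have -> : y *m P *m N = y *m L *m P.
    by rewrite /L -!mulmxA mulVmx // mulmx1.
  by rewrite yL -!mulmxA (mulmxA E) -Wk W0 mul0mx !mulmx0.
have := submx_trans yPker Kstab; rewrite -EP => /submxP[w].
rewrite mulmxA => /(congr1 (mulmx^~ (invmx P))); rewrite -!mulmxA mulmxV //.
rewrite !mulmx1 mul_mx_row mulmx1 mulmx0 => /eq_row_mx[_ x00].
by rewrite x00 eqxx in x0.
Qed.

(** Once changes of basis are block diagonal, the conditions indexed by [inPhi] only see these
    entries. *)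
Definition blockmask (K : pzRingType) m (b : 'I_m -> nat) (M : 'M[K]_m) : 'M[K]_m :=
  \matrix_(i, j) if b i == b j then M i j else 0.

(** * Null sets and images of locally Lipschitz maps *)

Section NullSets.
Variable R : realType.

(** Unlike [unpickle], [pickle_inv] returns a pair only at its own code, so flattening a double
    sequence visits no pair twice. *)
Definition nat_pair (k : nat) : option (nat * nat) := pickle_inv k.

Lemma nat_pairK k p : nat_pair k = Some p -> pickle p = k.
Proof.
by have := @pickle_invK (nat * nat)%type k; rewrite /nat_pair /ocancel => + kp; rewrite kp.
Qed.

Lemma nat_pair_pickle p : nat_pair (pickle p) = Some p.
Proof. exact: pickleK_inv. Qed.

(** The first [N] codes only reach pairs inside some finite square, whose sum is bounded row by
    row. *)
Lemma sum_nat_pair_le (w : nat * nat -> R) (e : nat -> R) eps :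
  (forall p, 0 <= w p) ->
  (forall i N, \sum_(j < N) w (i, val j) <= e i) ->
  (forall N, \sum_(i < N) e i <= eps) ->
  forall N, \sum_(k < N) oapp w 0 (nat_pair k) <= eps.
Proof.
move=> w0 we ee N.
pose d k := if nat_pair k is Some (i, j) then (i + j).+1 else 0%N.
pose M := (\max_(k < N) d k)%N.
apply: le_trans (ee M).
apply: le_trans (_ : _ <= \sum_(i < M) \sum_(j < M) w (val i, val j)) _; last first.
  by apply: ler_sum => i _; exact: we.
have -> : \sum_(i < M) \sum_(j < M) w (val i, val j) =
    \sum_(p : 'I_M * 'I_M) w (val p.1, val p.2).
  by rewrite pair_big.
pose c (p : 'I_M * 'I_M) : nat := pickle (val p.1, val p.2).
apply: le_trans (_ : _ <= \sum_(k < N) \sum_p (c p == k)%:R * w (val p.1, val p.2)) _.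
  apply: ler_sum => k _.
  have sum_ge0 : 0 <= \sum_p (c p == k)%:R * w (val p.1, val p.2).
    by apply: sumr_ge0 => p _; rewrite mulr_ge0.
  case kE : (nat_pair k) => [[i j]|] //=.
  have ijM : ((i + j).+1 <= M)%N.
    by have := leq_bigmax (F := fun k : 'I_N => d k) k; rewrite /= {1}/d kE.
  have iM : (i < M)%N by rewrite (leq_trans _ ijM) // ltnS leq_addr.
  have jM : (j < M)%N by rewrite (leq_trans _ ijM) // ltnS leq_addl.
  rewrite (bigD1 (Ordinal iM, Ordinal jM)) //= /c /=.
  rewrite (nat_pairK kE) eqxx mul1r lerDl; apply: sumr_ge0 => p _; exact: mulr_ge0.
rewrite exchange_big /=; apply: ler_sum => p _.
rewrite -mulr_suml ler_piMl // -natr_sum lern1.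
have [cN|cN] := ltnP (c p) N; last first.
  rewrite big1 // => k _; rewrite gtn_eqF // (leq_trans _ cN) //.
rewrite (bigD1 (Ordinal cN)) //= eqxx big1 // => k.
by rewrite -val_eqE /= eq_sym => /negPf ->.
Qed.


(** Lipschitz on every cube [-L, L]^T for the sup norm; the explicit bound [d] avoids forming a
    supremum over [T]. *)
Definition lip_loc (T : Type) (g : (T -> R) -> R) :=
  forall L : R, 0 <= L -> exists2 K, 0 <= K &
    forall x y d, 0 <= d -> (forall t, `|x t| <= L) -> (forall t, `|y t| <= L) ->
      (forall t, `|x t - y t| <= d) -> `|g x - g y| <= K * d.

Lemma lip_loc_cst (T : Type) (c : R) : lip_loc (fun _ : T -> R => c).
Proof. by move=> L _; exists 0 => // *; rewrite subrr normr0 mul0r. Qed.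

Lemma lip_loc_proj (T : Type) (t : T) : lip_loc (fun x : T -> R => x t).
Proof. by move=> L _; exists 1 => // x y d _ _ _ xy; rewrite mul1r. Qed.

Lemma lip_locD (T : Type) (f g : (T -> R) -> R) :
  lip_loc f -> lip_loc g -> lip_loc (fun x => f x + g x).
Proof.
move=> lf lg L L0; have [K K0 fK] := lf L L0; have [K' K'0 gK] := lg L L0.
exists (K + K') => [|x y d d0 xL yL xy]; first exact: addr_ge0.
rewrite opprD addrACA mulrDl (le_trans (ler_normD _ _)) // lerD //.
  exact: fK.
exact: gK.
Qed.

Lemma lip_locM (T : Type) (f g : (T -> R) -> R) :
  lip_loc f -> lip_loc g -> lip_loc (fun x => f x * g x).
Proof.
move=> lf lg L L0; have [K K0 fK] := lf L L0; have [K' K'0 gK] := lg L L0.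
(* A Lipschitz function is bounded on the cube, by comparison with its value at the origin. *)
have bnd h c x : (forall t, `|x t| <= L) ->
    (forall x y d, 0 <= d -> (forall t, `|x t| <= L) -> (forall t, `|y t| <= L) ->
      (forall t : T, `|x t - y t| <= d) -> `|h x - h y| <= c * d) ->
    `|h x| <= `|h (fun=> 0)| + c * L.
  move=> xL hc; rewrite -[h x](subrK (h (fun=> 0))) addrC.
  rewrite (le_trans (ler_normD _ _)) // lerD2l hc // => t.
    by rewrite normr0.
  by rewrite subr0.
set a := `|f (fun=> 0)| + K * L; set b := `|g (fun=> 0)| + K' * L.
have a0 : 0 <= a by rewrite addr_ge0 // mulr_ge0.
have b0 : 0 <= b by rewrite addr_ge0 // mulr_ge0.
exists (a * K' + b * K) => [|x y d d0 xL yL xy].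
  by rewrite addr_ge0 // mulr_ge0.
have -> : f x * g x - f y * g y = f x * (g x - g y) + g y * (f x - f y) by ring.
rewrite (le_trans (ler_normD _ _)) // !normrM mulrDl -!mulrA lerD //.
  by rewrite ler_pM // ?bnd ?gK.
by rewrite ler_pM // ?bnd ?fK.
Qed.

Section Boxes.
Variables (n m : nat).
Hypotheses (n_gt0 : (0 < n)%N) (m_gt0 : (0 < m)%N).
Let J := ('I_n * 'I_m * bool)%type.

Let j0 : J := (Ordinal n_gt0, Ordinal m_gt0, true).

Let prodJ0 : \prod_(x : J) (0 - 0 : R) = 0.
Proof. by rewrite (bigD1 j0) //= subrr mul0r. Qed.

Lemma mx_null_sub (E E' : 'M[R[i]]_(n, m) -> Prop) :
  (forall B, E' B -> E B) -> mx_null E -> mx_null E'.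
Proof.
move=> sE nE eps /nE[lo [hi [lohi [vol cov]]]]; exists lo, hi.
by split=> //; split=> // B /sE; apply: cov.
Qed.

(** The [i]-th set is covered within volume [eps / 2 ^+ i.+1]. Numbers that code no pair receive the
    box reduced to the origin, of volume zero because [J] is nonempty. *)
Lemma mx_null_bigcup (E : nat -> 'M[R[i]]_(n, m) -> Prop) :
  (forall k, mx_null (E k)) -> mx_null (fun B => exists k, E k B).
Proof.
move=> nE eps eps0; pose e (i : nat) := eps / 2 ^+ i.+1.
have e0 i : 0 < e i by rewrite divr_gt0 // exprn_gt0.
have /choice[b bP] i : exists b : (nat -> J -> R) * (nat -> J -> R),
    (forall k x, b.1 k x <= b.2 k x) /\
    (forall N, \sum_(k < N) \prod_(x : J) (b.2 k x - b.1 k x) <= e i) /\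
    (forall B, E i B -> exists k, forall x, b.1 k x <= realcoord B x <= b.2 k x).
  by have [lo [hi ?]] := nE i _ (e0 i); exists (lo, hi).
exists (fun k => oapp (fun p => (b p.1).1 p.2) (fun=> 0) (nat_pair k)).
exists (fun k => oapp (fun p => (b p.1).2 p.2) (fun=> 0) (nat_pair k)).
split=> [k x|]; first by case: nat_pair => //= p; have [/(_ p.2 x)] := bP p.1.
split=> [N|B [i EB]]; last first.
  have [_ [_ /(_ B EB)[j Bj]]] := bP i.
  by exists (pickle (i, j)); rewrite nat_pair_pickle.
pose w (p : nat * nat) := \prod_(x : J) ((b p.1).2 p.2 x - (b p.1).1 p.2 x).
rewrite [leLHS](_ : _ = \sum_(k < N) oapp w 0 (nat_pair k)); last first.
  by apply: eq_bigr => k _; case: nat_pair => //=; rewrite prodJ0.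
apply: (sum_nat_pair_le (e := e)) => [p|i M|M].
- by apply: prodr_ge0 => x _; rewrite subr_ge0; have [] := bP p.1.
- by have [_ []] := bP i.
- suff -> : \sum_(i < M) e i = eps - eps / 2 ^+ M.
    by rewrite gerBl divr_ge0 ?exprn_ge0 // ltW.
  elim: M => [|M IH]; first by rewrite big_ord0 expr0 divr1 subrr.
  rewrite big_ord_recr /= IH /e exprS; field.
  rewrite ?expf_neq0 ?pnatr_eq0 //.
Qed.

Lemma mx_null_image (T : finType) (F : (T -> R) -> J -> R)
    (E : 'M[R[i]]_(n, m) -> Prop) :
  (forall t, lip_loc (F^~ t)) -> (#|T| < n * m * 2)%N ->
  (forall B, E B -> exists x, forall t, realcoord B t = F x t) ->
  mx_null E.
Proof.
move=> lF TD EF.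
(* Exhaust the parameter space by the cubes [-L, L]^T and cut each of them by a grid of step 1/N. *)
pose EL (L : nat) B := exists2 x, (forall t : T, `|x t| <= L%:R) &
  forall t, realcoord B t = F x t.
apply: (mx_null_sub (E := fun B => exists L, EL L B)).
  move=> B /EF[x Bx].
  pose s := \sum_(t : T) `|x t|.
  exists (Num.truncn s).+1; exists x => // t; apply: ltW.
  apply: le_lt_trans (truncnS_gt s).
  by rewrite /s (bigD1 t) //= lerDl sumr_ge0.
apply: mx_null_bigcup => L eps eps0.
have /choice[Ks KsP] t : exists K, 0 <= K /\
    forall x y d, 0 <= d -> (forall t, `|x t| <= L%:R) -> (forall t, `|y t| <= L%:R) ->
      (forall t, `|x t - y t| <= d) -> `|F x t - F y t| <= K * d.
  by have [//|K] := lF t L%:R; exists K.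
pose K := \sum_t Ks t.
have KsK t : Ks t <= K.
  by rewrite /K (bigD1 t) //= lerDl sumr_ge0 // => i _; case: (KsP i).
have K0 : 0 <= K by rewrite sumr_ge0 // => i _; case: (KsP i).
set D := #|{: J}|; have DE : D = (n * m * 2)%N.
  by rewrite /D !card_prod !card_ord card_bool.
have TDlt : (#|T| < D)%N by rewrite DE.
(* At most ((2L+1)N)^#|T| boxes of volume (2K/N)^D will be used: in total at most c / N^(D - #|T|),
   hence at most c / N. *)
pose c := (2 * K) ^+ D * (2 * L%:R + 1) ^+ #|T|.
have c0 : 0 <= c by rewrite mulr_ge0 // exprn_ge0 ?addr_ge0 ?mulr_ge0.
pose N := (Num.truncn (c / eps)).+1.
have N0 : (0 : R) < N%:R by rewrite ltr0n.
have cN : c / N%:R <= eps.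
  rewrite ler_pdivrMr // mulrC -ler_pdivrMr //; exact/ltW/truncnS_gt.
pose G := {ffun T -> 'I_(2 * L * N).+1}.
pose p (g : G) t : R := (g t)%:R / N%:R - L%:R.
have pL g t : `|p g t| <= L%:R.
  have : (g t)%:R / N%:R <= 2 * L%:R :> R.
    by rewrite ler_pdivrMr // -!natrM ler_nat -ltnS.
  have : 0 <= (g t)%:R / N%:R :> R by rewrite divr_ge0 // ltW.
  by rewrite /p ler_norml; lra.
(* Rounding each coordinate down moves a point of the cube by at most 1/N, hence its image by at
   most [r]. *)
pose r := K / N%:R; have r0 : 0 <= r by rewrite divr_ge0 // ltW.
(* One box per grid point; indices from [#|G|] on get a degenerate box. *)
exists (fun k => oapp (fun i : 'I_#|G| => fun t => F (p (enum_val i)) t - r) (fun=> 0) (insub k)).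
exists (fun k => oapp (fun i : 'I_#|G| => fun t => F (p (enum_val i)) t + r) (fun=> 0) (insub k)).
split=> [k x|].
  by case: insubP => //= i _ _; rewrite lerD2l (le_trans _ r0) // oppr_le0.
split=> [M|B [x xL BF]]; last first.
  have gP t : (Num.truncn ((x t + L%:R) * N%:R) < (2 * L * N).+1)%N.
    have := xL t; rewrite ler_norml => /andP[xl xr].
    rewrite ltnS -(ler_nat R).
    apply: (@le_trans _ _ ((x t + L%:R) * N%:R)).
      by rewrite truncn_le mulr_ge0 //; lra.
    by rewrite !natrM ler_pM2r //; lra.
  pose g : G := [ffun t => Ordinal (gP t)].
  exists (enum_rank g) => t; rewrite valK /= enum_rankK.
  rewrite BF -ler_distl.
  have [Kt0] := KsP t; move=> /(_ x (p g) N%:R^-1) KtP.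
  apply: le_trans (KtP _ _ _ _) _ => //.
  - by rewrite invr_ge0 ltW.
  - move=> t'; rewrite /p ffunE /=; set z := (x t' + L%:R) * N%:R.
    have z0 : 0 <= z.
      by have := xL t'; rewrite ler_norml => /andP[? ?]; rewrite mulr_ge0 //; lra.
    have -> : x t' - ((Num.truncn z)%:R / N%:R - L%:R) = (z - (Num.truncn z)%:R) / N%:R.
      by rewrite mulrBl /z mulfK ?gt_eqF //; lra.
    have /andP[zl zr] := truncn_itv z0.
    rewrite normrM normfV (gtr0_norm N0); apply: ler_piMl; first by rewrite invr_ge0 ltW.
    by rewrite ler_norml; move: zr; rewrite -natr1; lra.
  - by rewrite ler_wpM2r // invr_ge0 ltW.
have -> : \sum_(k < M) \prod_(x : J)
   (oapp (fun i : 'I_#|G| => fun t => F (p (enum_val i)) t + r) (fun=> 0) (insub (k : nat)) x -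
    oapp (fun i : 'I_#|G| => fun t => F (p (enum_val i)) t - r) (fun=> 0) (insub (k : nat)) x) =
   (r *+ 2) ^+ D *+ minn M #|G|.
  elim: M => [|M IH]; first by rewrite big_ord0 min0n.
  rewrite big_ord_recr /= IH; case: insubP => [i iG _|] /=.
    under eq_bigr => x _ do rewrite opprD addrACA subrr add0r opprK -mulr2n.
    rewrite prodr_const -mulrSr; congr (_ *+ _).
    rewrite (minn_idPl _) ?(minn_idPl _) //.
    exact: ltnW.
  rewrite prodJ0 addr0 -leqNgt => GM; congr (_ *+ _).
  by rewrite !(minn_idPr _) // (leq_trans GM).
apply: le_trans (_ : (r *+ 2) ^+ D *+ #|G| <= _).
  by rewrite ler_wpMn2l ?exprn_ge0 ?mulrn_wge0 ?geq_minr.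
apply: le_trans cN.
rewrite card_ffun card_ord -mulr_natr natrX.
have NN : ((2 * L * N).+1%:R : R) <= (2 * L%:R + 1) * N%:R.
  have N1 : 1 <= N%:R :> R by rewrite ler1n.
  by rewrite -addn1 natrD !natrM; lra.
apply: le_trans (_ : (r *+ 2) ^+ D * ((2 * L%:R + 1) * N%:R) ^+ #|T| <= _).
  by rewrite ler_wpM2l ?exprn_ge0 ?mulrn_wge0 // lerXn2r ?nnegrE // (le_trans _ NN).
have -> : (r *+ 2) ^+ D * ((2 * L%:R + 1) * N%:R) ^+ #|T| = c * (N%:R ^+ #|T| / N%:R ^+ D).
  rewrite /r -mulr_natl mulrA !exprMn exprVn /c.
  by rewrite exprMn; ring.
rewrite ler_wpM2l // -(subnKC (ltnW TDlt)) exprD invfM mulrA mulfV ?mul1r; last first.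
  by rewrite expf_neq0 // gt_eqF.
rewrite lef_pV2 ?posrE ?exprn_gt0 //.
have -> : (D - #|T|)%N = (D - #|T|).-1.+1 by rewrite prednK // subn_gt0.
rewrite exprS ler_peMr ?(ltW N0) // exprn_ege1 //.
by rewrite ler1n.
Qed.

End Boxes.
End NullSets.

(** * Polynomial images and the locus of a vanishing determinant *)

Section Poly.
Variable R : realType.
Local Notation C := R[i].

Inductive polyfun (P : Type) : ((P -> C) -> C) -> Prop :=
| polyfun_cst c : polyfun (fun=> c)
| polyfun_proj p : polyfun (fun x => x p)
| polyfunD f g : polyfun f -> polyfun g -> polyfun (fun x => f x + g x)
| polyfunM f g : polyfun f -> polyfun g -> polyfun (fun x => f x * g x).

Lemma polyfun_sum (P I : Type) (r : seq I) (Q : pred I) (f : I -> (P -> C) -> C) :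
  (forall i, polyfun (f i)) -> polyfun (fun x => \sum_(i <- r | Q i) f i x).
Proof.
move=> pf; elim: r => [|i r IH].
  rewrite (_ : (fun _ => _) = fun=> 0); first exact: polyfun_cst.
  by apply: funext => x; rewrite big_nil.
rewrite (_ : (fun _ => _) = fun x => (if Q i then f i x else 0) + \sum_(i <- r | Q i) f i x).
  by apply: polyfunD => //; case: (Q i) => //; exact: polyfun_cst.
by apply: funext => x; rewrite big_cons; case: ifP; rewrite ?add0r.
Qed.

(** Real and imaginary parts of sums and products are themselves polynomial in those of the
    operands; [e] encodes complex parameters by real ones. *)
Lemma polyfun_lip_loc (P T : Type) (f : (P -> C) -> C) (e : (T -> R) -> P -> C) :
  polyfun f ->
  (forall p, lip_loc (fun z => complex.Re (e z p)) /\ lip_loc (fun z => complex.Im (e z p))) ->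
  lip_loc (fun z => complex.Re (f (e z))) /\ lip_loc (fun z => complex.Im (f (e z))).
Proof.
move=> pf le; elim: pf => {f} [c|p|f g _ [fr fi] _ [gr gi]|f g _ [fr fi] _ [gr gi]].
- by split; exact: lip_loc_cst.
- exact: le.
- split.
    rewrite (_ : (fun _ => _) = fun z => complex.Re (f (e z)) + complex.Re (g (e z))).
      exact: lip_locD.
    by apply: funext => z; case: (f _) => ? ?; case: (g _).
  rewrite (_ : (fun _ => _) = fun z => complex.Im (f (e z)) + complex.Im (g (e z))).
    exact: lip_locD.
  by apply: funext => z; case: (f _) => ? ?; case: (g _).
- split.
    rewrite (_ : (fun _ => _) = fun z => complex.Re (f (e z)) * complex.Re (g (e z)) +
        -1 * (complex.Im (f (e z)) * complex.Im (g (e z)))).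
      by apply: lip_locD; [|apply: lip_locM; [exact: lip_loc_cst|]]; exact: lip_locM.
    by apply: funext => z; rewrite mulN1r; case: (f _) => ? ?; case: (g _).
  rewrite (_ : (fun _ => _) = fun z => complex.Re (f (e z)) * complex.Im (g (e z)) +
      complex.Im (f (e z)) * complex.Re (g (e z))).
    by apply: lip_locD; exact: lip_locM.
  by apply: funext => z; case: (f _) => ? ?; case: (g _).
Qed.

Variables (n m : nat).
Hypotheses (n_gt0 : (0 < n)%N) (m_gt0 : (0 < m)%N).

(** [A] marks the free parameters among a convenient index type, the others being 0. Each free one
    counts for two real parameters, as each entry does in the target. *)
Lemma mx_null_polyimage (P : finType) (A : pred P) (F : (P -> C) -> 'M[C]_(n, m))
    (E : 'M[C]_(n, m) -> Prop) :
  (forall a c, polyfun (fun x => F x a c)) -> (#|A| < n * m)%N ->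
  (forall B, E B -> exists2 x, (forall p, ~~ A p -> x p = 0) & B = F x) ->
  mx_null E.
Proof.
move=> pF cA EF; pose T := ({p : P | A p} * bool)%type.
pose e (z : T -> R) p : C :=
  oapp (fun u : {p : P | A p} => complex.Complex (z (u, true)) (z (u, false))) 0 (insub p).
pose G z (t : 'I_n * 'I_m * bool) : R := realcoord (F (e z)) t.
apply: (mx_null_image n_gt0 m_gt0 (T := T) (F := G)) => [[[a c] s]||B EB].
- have [|re im] := @polyfun_lip_loc P T _ e (pF a c).
    move=> p; rewrite /e; case: insubP => /= [u _ _|_]; last by split; exact: lip_loc_cst.
    by split; exact: lip_loc_proj.
  by rewrite /G /realcoord /=; case: s.
- by rewrite card_prod card_bool card_sig ltn_mul2r cA.
- have [x x0 ->] := EF B EB.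
  exists (fun t => if t.2 then complex.Re (x (val t.1)) else complex.Im (x (val t.1))).
  move=> t; rewrite /G; congr (realcoord (F _) t); apply: funext => p.
  rewrite /e; case: insubP => /= [u _ <-|/x0//].
  by case: (x _).
Qed.

Lemma mx_null_fin_bigcup (I : countType) (E : I -> 'M[C]_(n, m) -> Prop) :
  (forall j, mx_null (E j)) -> mx_null (fun B => exists j, E j B).
Proof.
move=> nE; pose E' k B := if unpickle k is Some j then E j B else False.
apply: (mx_null_sub (E := fun B => exists k, E' k B)).
  by move=> B [j EB]; exists (pickle j); rewrite /E' pickleK.
apply: mx_null_bigcup => // k; rewrite /E'; case: unpickle => // .
(* Numbers that code no index contribute the empty set, handled as a case with no parameters. *)
apply: (mx_null_polyimage (P := void) (A := predT) (F := fun=> 0)) => //.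
  by move=> a c; exact: polyfun_cst.
by rewrite card_void muln_gt0 n_gt0.
Qed.

Lemma mx_null_det_blockmask (Q : 'M[C]_(m, n)) (b : 'I_m -> nat) :
  Q *m mxH Q = 1%:M ->
  mx_null (fun B => \det (blockmask b (Q *m B)) = 0).
Proof.
move=> QQ.
(* A kernel vector is scaled to 1 at a nonzero coordinate [j], and only its equations in the block
   of [j] are kept. *)
pose E j (B : 'M[C]_(n, m)) := exists2 v : 'I_m -> C, v j = 1 &
  forall i, b i = b j -> \sum_(p | b p == b j) (Q *m B) i p * v p = 0.
apply: (mx_null_sub (E := fun B => exists j, E j B)).
  move=> B; rewrite -det_tr => /eqP/det0P[v v0 vC].
  have [j vj] : exists j, v 0 j != 0.
    apply/existsP; apply: contraNT v0; rewrite negb_exists => /forallP v0.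
    by apply/eqP/rowP => j; rewrite mxE; apply/eqP; rewrite -[_ == _]negbK.
  exists j, (fun p => v 0 p / v 0 j); first by rewrite divff.
  move=> i ij; have := congr1 (fun M : 'rV_m => M 0 i) vC.
  rewrite !mxE => vi.
  transitivity ((\sum_p v 0 p * (blockmask b (Q *m B))^T p i) / v 0 j).
    rewrite mulr_suml.

    rewrite [LHS]big_mkcond /=; apply: eq_bigr => p _.
    rewrite [in RHS]mxE [in RHS]mxE ij eq_sym.
    by case: ifP => _; rewrite ?mulr0 ?mul0r //; ring.
  by rewrite vi mul0r.
apply: mx_null_fin_bigcup => j.
pose D := [set p | b p == b j].
pose QD := rowsub (fun i : 'I_#|D| => enum_val i) Q.
have rQD : \rank QD = #|D|.
  exact/orthonormal_rank/orthonormal_rowsub/QQ/enum_val_inj.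
pose K := kermx QD^T.
have rK : \rank K = (n - #|D|)%N by rewrite mxrank_ker mxrank_tr rQD.
have jD : j \in D by rewrite inE.
have Dn : (#|D| <= n)%N by rewrite -rQD rank_leq_col.
pose P : finType := (('I_n * 'I_m) + ('I_m + 'I_(\rank K)))%type.
pose A : pred P := fun p => match p with
  | inl ac => ac.2 != j | inr (inl q) => (q \in D) && (q != j) | _ => true end.
(* Parameters: all columns but j, the other coefficients of the dependency in
   the block of j, and the combination of columns itself, which QD kills. *)
pose F (x : P -> C) : 'M[C]_(n, m) := \matrix_(a, c)
  if c == j then \sum_t x (inr (inr t)) * row_base K t a -
    \sum_(q | (q \in D) && (q != j)) x (inr (inl q)) * x (inl (a, q))
  else x (inl (a, c)).
apply: (mx_null_polyimage (A := A) (F := F)) => [a c||B [v vj Bv]].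
- rewrite (_ : (fun _ => _) = fun x => if c == j then
      \sum_t x (inr (inr t)) * row_base K t a +
      -1 * (\sum_(q | (q \in D) && (q != j)) x (inr (inl q)) * x (inl (a, q)))
    else x (inl (a, c))); last first.
    by apply: funext => x; rewrite mxE mulN1r.
  case: eqP => _; last exact: polyfun_proj.
  apply: polyfunD; [|apply: polyfunM; first exact: polyfun_cst];
    apply: polyfun_sum => t; apply: polyfunM; try exact: polyfun_proj.
  exact: polyfun_cst.
(* The three terms count the other columns, the other coefficients in the block, and the coordinates
   of the combination in [K]: n m - 1 in all. *)
- have -> : #|A| = (n * m.-1 + (#|D|.-1 + (n - #|D|)))%N.
    rewrite -sum1_card big_sumType /= big_sumType /=; congr (_ + (_ + _))%N.
    - rewrite -(pair_big_dep xpredT (fun _ c => c != j) (fun _ _ => 1%N)) /=.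
      under eq_bigr => a _ do rewrite sum1_card cardC1 card_ord.
      by rewrite sum_nat_const card_ord.
    - rewrite (cardsD1 j) jD add1n /= -sum1_card; apply: eq_bigl => q.
      by rewrite unfold_in /= in_setD1 andbC.
    - rewrite -rK; transitivity (\sum_(t < \rank K) 1)%N; first exact: eq_bigl.
      by rewrite big_const_ord iter_addn_0 mul1n.
  have D0 : (0 < #|D|)%N by apply/card_gt0P; exists j.
  rewrite -[m in X in (_ < X)%N](prednK m_gt0) mulnS addnC ltn_add2r.
  by rewrite -[X in (_ < X)%N](subnKC Dn) ltn_add2r prednK.
(* By [Bv], [QD] kills [y], so [y] has coordinates [w] in the basis of [K]. Since [v j = 1], column
   [j] of [B] is [y] minus the other terms. *)
- pose y : 'cV_n := \sum_(p | p \in D) v p *: col p B.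
  have /submxP[w yw] : (y^T <= row_base K)%MS.
    rewrite eq_row_base; apply/sub_kermxP; rewrite -trmx_mul.
    apply/(canLR trmxK); rewrite trmx0; apply/colP => i.
    rewrite mxE [RHS]mxE; have := enum_valP i; rewrite inE => /eqP/Bv.
    move=> Bvi; rewrite -[RHS]Bvi.
    under eq_bigr => a _.
      rewrite mxE /y summxE mulr_sumr.
      under eq_bigr => p _ do rewrite !mxE.
      over.
    rewrite exchange_big /=; apply: eq_big => [p|p _]; first by rewrite inE.
    by rewrite mxE mulr_suml; apply: eq_bigr => a _; ring.
  exists (fun p => match p with
    | inl ac => if ac.2 != j then B ac.1 ac.2 else 0
    | inr (inl q) => if (q \in D) && (q != j) then v q else 0
    | inr (inr t) => w 0 t end).
    by case=> [[a c]|[q|t]] /=; [move=> /negPf ->|move=> /negPf ->|].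
  apply/matrixP => a c; rewrite mxE; case: ifPn => [/eqP ->|/= cj]; last by rewrite cj.
  have -> : \sum_t w 0 t * row_base K t a = y a 0.
    by have := congr1 (fun M : 'rV_n => M 0 a) yw; rewrite !mxE => ->.
  rewrite /y summxE (bigD1 j) //= !mxE vj mul1r.
  set s1 := \sum_(_ | _) _; set s2 := \sum_(_ | _) _.
  suff -> : s1 = s2 by rewrite addrK.
  by apply: eq_bigr => q /andP[qD qj]; rewrite !mxE qD qj.
Qed.

End Poly.

(** * Block indices and block-diagonal matrices *)

Lemma muS ms l : mu ms l.+1 = (mu ms l + nth 0 ms l)%N.
Proof. by rewrite /mu big_ord_recr. Qed.

Lemma mu_mono ms : {homo mu ms : l l' / (l <= l')%N}.
Proof. by apply: homo_leq leq_trans _ => // l; rewrite muS leq_addr. Qed.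

(** As [mu] is nondecreasing, the indices counted by [blk] form an initial segment, so its length is
    compared with [l] by testing one boundary. *)
Lemma blk_ltE ms p l : (l <= size ms)%N -> (blk ms p < l)%N = (p < mu ms l)%N.
Proof.
move=> ls; pose a j := (mu ms j.+1 <= p)%N.
have -> : blk ms p = (count a (iota 0 l) + count a (iota l (size ms - l)))%N.
  by rewrite -count_cat -iotaD subnKC.
have [pl|pl] := ltnP p (mu ms l).
  have -> : count a (iota l (size ms - l)) = 0%N.
    apply/eqP; rewrite -leqn0 leqNgt -has_count -all_predC; apply/allP => j.
    rewrite mem_iota => /andP[lj _]; rewrite /= -ltnNge (leq_trans pl) //.
    by apply: mu_mono; rewrite ltnW.
  rewrite addn0; case: l pl ls => [|l] pl ls.
    by rewrite /mu big_ord0 in pl.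
  rewrite ltnNge; apply/negP => le.
  have : all a (iota 0 l.+1).
    by rewrite all_count eqn_leq count_size size_iota le.
  move=> /allP/(_ l); rewrite mem_iota /a leq0n ltnSn leqNgt pl.
  by move=> /(_ isT).
apply/negbTE; rewrite -leqNgt (leq_trans _ (leq_addr _ _)) //.
rewrite -[X in (X <= _)%N](size_iota 0 l) -count_predT.
rewrite leq_eqVlt; apply/orP; left; apply/eqP/eq_in_count => j.
rewrite mem_iota /= => jl; rewrite /a (leq_trans _ pl) //.
exact: mu_mono.
Qed.

Lemma blk_mono ms : {homo blk ms : p q / (p <= q)%N}.
Proof. by move=> p q pq; apply: sub_count => l /= /leq_trans; apply. Qed.

(* The masked matrix commutes with diag(b), hence so does its inverse. *)
Lemma blockmask_inv (K : numFieldType) m (b : 'I_m -> nat) (M : 'M[K]_m) i j :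
  blockmask b M \in unitmx -> b i != b j -> invmx (blockmask b M) i j = 0.
Proof.
set C := blockmask b M => Cu bij; pose D : 'M[K]_m := diag_mx (\row_k (b k)%:R).
have CD : C *m D = D *m C.
  rewrite mul_diag_mx mul_mx_diag; apply/matrixP => p q; rewrite !mxE.
  by case: eqP => [->|]; rewrite ?mulr0 ?mul0r // mulrC.
have : invmx C *m D = D *m invmx C.
  transitivity (invmx C *m (D *m C) *m invmx C).
    by rewrite -!mulmxA mulmxV ?mulmx1.
  by rewrite -CD mulmxA mulVmx // mul1mx.
rewrite mul_diag_mx mul_mx_diag => /matrixP/(_ i j); rewrite !mxE mulrC => /eqP.
rewrite -subr_eq0 -mulrBl mulf_eq0 subr_eq0 eqr_nat eq_sym (negPf bij) /=.
by move/eqP.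
Qed.

(** * Kernels of powers and the Weyr characteristic, on row vectors *)

Section Kernels.
Variables (K : closedFieldType) (n : nat) (A : 'M[K]_n) (lambda : K).
Local Notation N := (A^T - lambda%:M).

Lemma kermxX_mono : {homo (fun j => kermx (N ^+ j)) : i j / (i <= j)%N >-> (i <= j)%MS}.
Proof.
move=> i j /subnKC <-; apply/sub_kermxP.
by rewrite exprD -mulmxE mulmxA mulmx_ker mul0mx.
Qed.

Lemma dimkerX j : dimker ((A - lambda%:M) ^+ j) = \rank (kermx (N ^+ j)).
Proof.
rewrite /dimker; congr (\rank (kermx _)).
elim: j => [|j IH]; first by rewrite !expr0 trmx1.
rewrite exprS -mulmxE trmx_mul IH exprSr -mulmxE; congr (_ *m _).
by rewrite linearB /= tr_scalar_mx.
Qed.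

Variable ms : seq nat.
Hypothesis hweyr : forall j : nat, (j < size ms)%N ->
     weyr A lambda j.+1 = nth 0%N ms j /\ (0 < nth 0%N ms j)%N.

Lemma rank_kermxX j : (j <= size ms)%N -> \rank (kermx (N ^+ j)) = mu ms j.
Proof.
elim: j => [|j IH] js.
  by rewrite expr0 mxrank_ker mxrank1 subnn /mu big_ord0.
(* The Weyr number is a truncated difference; its positivity makes it a true one, so the ranks
   telescope. *)
have [] := hweyr js; rewrite /weyr !dimkerX /= muS -(IH (ltnW js)) => <-.
by rewrite subn_gt0 => /ltnW/subnKC ->.
Qed.

(** A zero Weyr number after the last block means that the kernels have stabilized at exponent
    [size ms]. *)
Lemma mup_char_poly_mu : weyr A lambda (size ms).+1 = 0%N ->
  mup lambda (char_poly A) = mu ms (size ms).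
Proof.
rewrite /weyr !dimkerX => /eqP; rewrite subn_eq0 /= => le.
rewrite -rank_kermxX // -char_poly_tr; apply: mup_char_poly_kermx.
by rewrite -(mxrank_leqif_sup (kermxX_mono (leqnSn _))) eqn_leq le mxrankS ?kermxX_mono.
Qed.

End Kernels.

(** * Adapted orthonormal families and staircase forms *)

Section Core.
Variables (C : numClosedFieldType) (n m : nat) (A : 'M[C]_n) (lambda : C).
Variable ms : seq nat.
Local Notation N := (A^T - lambda%:M).
Local Notation K j := (kermx (N ^+ j)).
Hypothesis rK : forall j, (j <= size ms)%N -> \rank (K j) = mu ms j.
Hypothesis mE : m = mu ms (size ms).

Lemma blk_lt (i : 'I_m) : (blk ms i < size ms)%N.
Proof. by rewrite blk_ltE // -mE. Qed.

(* Row-vector convention: X stands for the transpose of the paper's U. *)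
Definition adapted (X : 'M[C]_(m, n)) :=
  X *m mxH X = 1%:M /\ forall i, (row i X <= K (blk ms i).+1)%MS.

Lemma adapted_exists : exists X, adapted X.
Proof.
have [|X XX XK] := @flag_orthonormal C n (fun i => K (blk ms i).+1) m.
  move=> i im; have iS := blk_lt (Ordinal im).
  by rewrite rK // -blk_ltE.
by exists X.
Qed.

(** The rows of [X] in the first [l] blocks number [mu ms l], the rank of [K l], and lie in it. *)
Lemma adapted_coord X l (v : 'rV_n) : adapted X -> (l <= size ms)%N -> (v <= K l)%MS ->
  v = v *m mxH X *m X /\ forall j : 'I_m, (l <= blk ms j)%N -> (v *m mxH X) 0 j = 0.
Proof.
move=> [XX XK] ls vK.
have [||i il|vX v0] := flag_coord (F := K l) (r := mu ms l) (v := v) XX _ _ _ vK.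
- by rewrite mE mu_mono.
- by rewrite rK.
- by apply: submx_trans (XK i) _; apply: kermxX_mono; rewrite blk_ltE.
- by split=> // j lj; apply: v0; rewrite leqNgt -blk_ltE // -leqNgt.
Qed.

Lemma mxH_tr p q (X : 'M[C]_(p, q)) : mxH X^T = map_mx Num.conj X.
Proof. by rewrite /mxH map_trmx trmxK. Qed.

Lemma orthonormal_tr (U : 'M[C]_(n, m)) :
  mxH U *m U = 1%:M <-> U^T *m mxH U^T = 1%:M.
Proof.
rewrite mxH_tr -[map_mx _ U]trmxK -trmx_mul.
by split=> [->|/(canRL trmxK) ->]; rewrite trmx1.
Qed.

Lemma invariant_eq (U : 'M[C]_(n, m)) (S : 'M[C]_m) :
  A *m U - U *m (lambda%:M + S) = (U^T *m N - S^T *m U^T)^T.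
Proof.
rewrite linearB /= !trmx_mul !trmxK linearB /= trmxK tr_scalar_mx.
by rewrite mulmxBl mulmxDr opprD addrA -scalar_mxC.
Qed.

Lemma invariant_compression (U : 'M[C]_(n, m)) (S : 'M[C]_m) :
  mxH U *m U = 1%:M -> A *m U - U *m (lambda%:M + S) = 0 ->
  S = mxH U *m (A - lambda%:M) *m U.
Proof.
move=> UU /eqP; rewrite mulmxDr opprD addrA scalar_mxC -mulmxBl subr_eq0 => /eqP E.
by rewrite -mulmxA E mulmxA UU mul1mx.
Qed.

(** Induction on the block: [N] sends row [i] of [U^T] to a combination of rows of strictly earlier
    blocks, all in [K (blk ms i)] by induction. *)
Lemma adapted_of_invariant (U : 'M[C]_(n, m)) (S : 'M[C]_m) :
  mxH U *m U = 1%:M -> staircase ms S ->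
  A *m U - U *m (lambda%:M + S) = 0 -> adapted U^T.
Proof.
move=> /orthonormal_tr UU Ss; rewrite invariant_eq => /(canRL trmxK).
rewrite trmx0 => /eqP; rewrite subr_eq0 => /eqP E; split=> // i.
have [b] := ubnP (blk ms i); elim: b i => // b IH i; rewrite ltnS => ib.
apply/sub_kermxP; rewrite exprS -mulmxE mulmxA -row_mul E; apply/sub_kermxP.
rewrite row_mul mulmx_sum_row; apply: summx_sub => p _; rewrite !mxE.
have [pi|ip] := ltnP (blk ms p) (blk ms i); last by rewrite Ss // scale0r sub0mx.
by rewrite scalemx_sub // (submx_trans (IH p (leq_trans pi ib))) ?kermxX_mono.
Qed.

(** [N] maps [K l.+1] into [K l], so the image of a row expands in rows of strictly earlier blocks;
    the coefficients form [S^T]. *)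
Lemma adapted_invariant X : adapted X ->
  let S := (X *m N *m mxH X)^T in
  staircase ms S /\ A *m X^T - X^T *m (lambda%:M + S) = 0.
Proof.
move=> aX S; have [_ XK] := aX.
have XN (i : 'I_m) := adapted_coord (l := blk ms i) (v := row i (X *m N)) aX (ltnW (blk_lt i)).
have XNK (i : 'I_m) : (row i (X *m N) <= K (blk ms i))%MS.
  apply/sub_kermxP; rewrite row_mul -mulmxA mulmxE -exprS; exact/sub_kermxP.
split.
  move=> p q qp; rewrite mxE; have [_ /(_ _ qp)] := XN q (XNK q).
  by rewrite -row_mul mxE.
rewrite invariant_eq !trmxK; apply/(canLR trmxK); rewrite trmx0.
apply/eqP; rewrite subr_eq0; apply/eqP/row_matrixP => i.
by have [-> _] := XN i (XNK i); rewrite -!row_mul.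
Qed.

(** Expanding [X] in [Q] kills the coefficients in later blocks. Expanding [Q] in [X] does the same
    for [mxH T], leaving only the diagonal blocks. *)
Lemma adapted_change X Q : adapted X -> adapted Q ->
  let T := X *m mxH Q in
  [/\ X = T *m Q, T *m mxH T = 1%:M & forall i j : 'I_m, blk ms i != blk ms j -> T i j = 0].
Proof.
move=> aX aQ T; have XQ : X = T *m Q.
  apply/row_matrixP => i.
  have [] := adapted_coord aQ (blk_lt i) (aX.2 i).
  by rewrite -!row_mul.
split=> // [|i j].
  by rewrite {1}/T -mulmxA -mxHM -XQ; have [] := aX.
rewrite neq_ltn => /orP[ij|ji].
  have [_ /(_ _ ij)] := adapted_coord aQ (blk_lt i) (aX.2 i).
  by rewrite -row_mul mxE.
have [_ /(_ _ ji)] := adapted_coord aX (blk_lt j) (aQ.2 j).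
rewrite -row_mul mxE => QX; have -> : T = mxH (Q *m mxH X) by rewrite mxHM mxHK.
by rewrite mxHE QX rmorph0.
Qed.

Lemma adapted_mul T Q : adapted Q -> T *m mxH T = 1%:M ->
  (forall i j : 'I_m, (blk ms i < blk ms j)%N -> T i j = 0) -> adapted (T *m Q).
Proof.
move=> [QQ QK] TT T0; split=> [|i].
  by rewrite mxHM mulmxA -(mulmxA T) QQ mulmx1.
rewrite row_mul mulmx_sum_row; apply: summx_sub => j _; rewrite mxE.
have [ij|ji] := ltnP (blk ms i) (blk ms j); first by rewrite T0 // scale0r sub0mx.
by rewrite scalemx_sub // (submx_trans (QK j)) ?kermxX_mono.
Qed.

(** For [i] and [j] in one block, the factor [T] restricts the sum to that block, where the mask
    changes nothing; across blocks a product of block-diagonal matrices vanishes. *)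
Lemma Phi_lower (T : 'M[C]_m) (Q : 'M_(m, n)) (B : 'M_(n, m)) :
  (forall i j : 'I_m, blk ms i != blk ms j -> T i j = 0) ->
  (forall i j : 'I_m, inPhi ms i j -> (mxH (T *m Q)^T *m B) i j = 0) <->
  (forall i j : 'I_m, (i < j)%N ->
    (map_mx Num.conj T *m blockmask (fun k : 'I_m => blk ms k) (map_mx Num.conj Q *m B)) i j = 0).
Proof.
move=> T0; set M := blockmask _ _.
have E (i j : 'I_m) : blk ms i == blk ms j ->
    (mxH (T *m Q)^T *m B) i j = (map_mx Num.conj T *m M) i j.
  move=> ij; rewrite mxH_tr map_mxM -mulmxA !mxE; apply: eq_bigr => p _.
  rewrite [in RHS]mxE [M p j]mxE; case: ifPn => [_|pj].
    by rewrite mxE.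
  have Tip : T i p = 0 by apply: T0; rewrite (eqP ij) eq_sym.
  by rewrite mxE mulr0 Tip rmorph0 mul0r.
split=> H i j.
  move=> ij; have [bij|bij] := boolP (blk ms i == blk ms j).
    by rewrite -E // H // /inPhi ij.
  rewrite mxE big1 // => p _; rewrite !mxE; case: eqP => [pj|]; last by rewrite mulr0.
  by rewrite T0 ?rmorph0 ?mul0r // pj.
by move=> /andP[ij bij]; rewrite E // H.
Qed.

End Core.

(** * Existence and uniqueness of the QL factorization *)

Section Triangular.
Variables (C : numClosedFieldType) (m : nat) (M : 'M[C]_m).
Hypothesis Mu : M \in unitmx.

Definition lower (L : 'M[C]_m) := forall i j : 'I_m, (i < j)%N -> L i j = 0.

(** The span of the first [i.+1] rows of the inverse of [M]: the vectors whose product with [M] is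
    supported on the first [i.+1] coordinates. Lower triangularity of [V *m M] thus says that row
    [i] of [V] lies in [F i]. *)
Let F i : 'M[C]_m := pid_mx i.+1 *m invmx M.

Let rankF i : (i < m)%N -> \rank (F i) = i.+1.
Proof.
move=> im; rewrite /F mxrankMfree ?row_free_unit ?unitmx_inv //.
by rewrite rank_pid_mx.
Qed.

Lemma QL_exists : exists2 V : 'M[C]_m, V *m mxH V = 1%:M & lower (V *m M).
Proof.
have [|V VV VF] := @flag_orthonormal C m F m; first by move=> i /rankF ->.
exists V => // i j ij; have /submxP[w wV] := VF i.
have -> : (V *m M) i j = (row i V *m M) 0 j by rewrite -row_mul [RHS]mxE.
rewrite wV /F mulmxA mulmxKV // mxE big1 // => k _; rewrite mxE.
case: eqP => [kj|] /=; last by rewrite mulr0.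
by rewrite kj ltnS leqNgt ij mulr0.
Qed.

Lemma lower_flag V (i j : 'I_m) : lower (V *m M) -> (j <= i)%N -> (row j V <= F i)%MS.
Proof.
move=> VL ji; apply/submxP; exists (row j (V *m M)).
rewrite /F mulmxA -[row j V](mulmxK Mu) -row_mul; congr (_ *m _).
apply/rowP => k; rewrite [RHS]mxE (bigD1 k) //= big1 => [|p pk].
  rewrite [pid_mx _ _ _]mxE eqxx addr0 /=; have [ki|ik] := ltnP k i.+1.
    by rewrite mulr1.
  by rewrite mulr0 mxE VL // (leq_ltn_trans ji).
by rewrite [pid_mx _ _ _]mxE val_eqE (negPf pk) mulr0.
Qed.

(** The rows of [V] and [V'] follow the same flag [F], so [V' *m mxH V] and its conjugate transpose
    are both lower triangular: it is a diagonal unitary matrix. *)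
Lemma QL_unique (V V' : 'M[C]_m) : V *m mxH V = 1%:M -> V' *m mxH V' = 1%:M ->
  lower (V *m M) -> lower (V' *m M) ->
  exists2 d : 'rV[C]_m, (forall i, `|d 0 i| = 1) & V' = diag_mx d *m V.
Proof.
have aux (X Y : 'M[C]_m) : X *m mxH X = 1%:M -> lower (X *m M) -> lower (Y *m M) ->
    Y = Y *m mxH X *m X /\ lower (Y *m mxH X).
  move=> XX XL YL.
  have c (i : 'I_m) := flag_coord (F := F i) (r := i.+1) (v := row i Y) XX
    (ltn_ord i) (eq_leq (rankF (ltn_ord i))) (fun j ji => lower_flag XL ji)
    (lower_flag YL (leqnn i)).
  split=> [|i j ij].
    by apply/row_matrixP => i; have [] := c i; rewrite -!row_mul.
  by have [_ /(_ _ ij)] := c i; rewrite -row_mul mxE.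
move=> VV VV' VL VL'; have [V'E WL] := aux V V' VV VL VL'.
have [_ WL'] := aux V' V VV' VL' VL.
have [W WD] : exists W, W = V' *m mxH V by eexists.
rewrite -WD in V'E WL.
have WE : W = diag_mx (\row_i W i i).
  apply/matrixP => i j; rewrite !mxE.
  have [->|] := eqVneq i j; first by rewrite mulr1n.
  rewrite mulr0n -val_eqE neq_ltn => /orP[/WL//|/WL' VW0].
  transitivity (mxH (V *m mxH V') i j); first by rewrite mxHM mxHK WD.
  by rewrite mxHE VW0 rmorph0.
exists (\row_i W i i) => [i|]; last by rewrite -WE.
have WW : W *m mxH W = 1%:M by rewrite {2}WD mxHM mxHK mulmxA -V'E.
have /matrixP/(_ i i) := WW; rewrite !mxE eqxx (bigD1 i) //= big1 => [|k ki].
  rewrite !mxE addr0 -normCK => /eqP; rewrite sqrf_eq1 => /orP[/eqP//|/eqP N1].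
  have : 0 <= (-1 : C) by rewrite -N1.
  by rewrite oppr_ge0 ler10.
by rewrite WE !mxE eq_sym (negPf ki) mulr0n mul0r.
Qed.

End Triangular.

(** * From QL factorization to the statement for almost all vectors *)

Theorem theorem1 (R : realType) (n : nat) (A : 'M[R[i]]_n) (lambda : R[i])
  (m : nat) (ms : seq nat)
  (hm : mup lambda (char_poly A) = m) (hm0 : (0 < m)%N)
  (hweyr : forall j : nat, (j < size ms)%N ->
     weyr A lambda j.+1 = nth 0%N ms j /\ (0 < nth 0%N ms j)%N)
  (hweyr0 : weyr A lambda (size ms).+1 = 0%N) :
  mx_null (fun B : 'M[R[i]]_(n, m) =>
    ~ ((exists (U : 'M[R[i]]_(n, m)) (S : 'M[R[i]]_m),
          mxH U *m U = 1%:M /\ staircase ms S /\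
          A *m U - U *m (lambda%:M + S) = 0 /\
          (forall i j : 'I_m, inPhi ms i j -> (mxH U *m B) i j = 0) /\
          (forall (Uh : 'M[R[i]]_(n, m)) (Sh : 'M[R[i]]_m),
             mxH Uh *m Uh = 1%:M -> staircase ms Sh ->
             A *m Uh - Uh *m (lambda%:M + Sh) = 0 ->
             (forall i j : 'I_m, inPhi ms i j -> (mxH Uh *m B) i j = 0) ->
             Sh = mxH Uh *m (A - lambda%:M) *m Uh /\
             exists alpha : 'I_m -> R[i],
               (forall i, `|alpha i| = 1) /\
               Uh = U *m diag_mx (\row_i alpha i))))).
Proof.
have mE : m = mu ms (size ms) by rewrite -hm (mup_char_poly_mu hweyr hweyr0).
have rK := rank_kermxX hweyr.
have n_gt0 : (0 < n)%N.
  by rewrite (leq_trans hm0) // mE -rK // rank_leq_row.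
have [Q aQ] := adapted_exists rK mE.
pose b (i : 'I_m) := blk ms i.
(* With [U = X^T], [mxH U] is the entrywise conjugate of [X]; hence the conjugates around the QL
   factorization. *)
pose cj p q := map_mx Num.conj : 'M[R[i]]_(p, q) -> 'M[R[i]]_(p, q).
have cjO p q (X : 'M[R[i]]_(p, q)) :
    X *m mxH X = 1%:M -> cj _ _ X *m mxH (cj _ _ X) = 1%:M.
  move=> XX; rewrite -[RHS](map_mx1 Num.conj) -XX map_mxM; congr (_ *m _).
  by apply/matrixP => i j; rewrite !mxE.
have cjK p q (X : 'M[R[i]]_(p, q)) : cj _ _ (cj _ _ X) = X.
  by apply/matrixP => i j; rewrite !mxE conjCK.
apply: mx_null_sub (mx_null_det_blockmask n_gt0 hm0 b (cjO _ _ _ aQ.1)) => B nex.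
apply: contrapT => /eqP detM; apply: nex; set M := blockmask b _ in detM.
have Mu : M \in unitmx by rewrite unitmxE unitfE.
have [V VV VL] := QL_exists Mu.
(* A lower triangular matrix times a block-diagonal inverse is block lower triangular, which is
   enough for [adapted_mul]. *)
have VE : V = V *m M *m invmx M by rewrite mulmxK.
have V0 (i j : 'I_m) : (blk ms i < blk ms j)%N -> V i j = 0.
  move=> ij; rewrite VE mxE big1 // => p _.
  have [ip|pi] := ltnP i p; first by rewrite VL ?mul0r.
  rewrite [invmx M p j]blockmask_inv ?mulr0 // /b neq_ltn.
  by rewrite (leq_ltn_trans (blk_mono ms pi)).
have aX : adapted A lambda ms (cj _ _ V *m Q).
  by apply: adapted_mul (cjO _ _ _ VV) _ => // i j ij; rewrite mxE V0 ?rmorph0.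
(* Here the change of basis is the conjugate of [V] itself, which is therefore block diagonal. *)
have [_ _] := adapted_change rK mE aX aQ.
rewrite -mulmxA aQ.1 mulmx1 => T0.
have [Ss UE] := adapted_invariant rK mE aX.
set S := (_ *m _ *m _)^T in Ss UE.
exists (cj _ _ V *m Q)^T, S; split; first by apply/orthonormal_tr; rewrite trmxK; exact: aX.1.
split=> //; split=> //; split.
  by apply/(Phi_lower Q B T0) => i j ij; rewrite [map_mx _ (cj _ _ V)]cjK VL.
move=> Uh Sh UU Shs UhE Phi; split; first exact: invariant_compression.
have aY := adapted_of_invariant UU Shs UhE.
have [YE TT T0'] := adapted_change rK mE aY aQ.
set T := _ *m mxH Q in YE TT T0'.
(* The conjugate of [T] is a second unitary factor for the same [M], so it differs from [V] by the
   phases [d]; undoing the conjugation turns them into their conjugates. *)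
have [|d dn VVE] := QL_unique Mu VV (cjO _ _ _ TT) VL.
  by have := (Phi_lower Q B T0').1; rewrite -YE trmxK; apply.
exists (fun i => (d 0 i)^*); split=> [i|]; first by rewrite norm_conjC.
apply: trmx_inj; rewrite trmx_mul trmxK tr_diag_mx YE -[T]cjK VVE.
rewrite /cj map_mxM map_diag_mx -mulmxA; congr (diag_mx _ *m _).
by apply/rowP => i; rewrite !mxE.
Qed.
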